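(* There are infinitely many fields $K$ of totally real algebraic numbers (subfields of $\mathbb{C}$) such that $A(\mathcal{O}_K)$ is different from $\{+\infty\}$ and different from the set $\{t\in\mathbb{R}\cup\{+\infty\} : t\ge 4\}$.
   Context: A field $K\subset\mathbb{C}$, algebraic over $\mathbb{Q}$ (possibly of infinite degree), is a field of totally real algebraic numbers if for every element of $K$ all its conjugates over $\mathbb{Q}$ are real. $\mathcal{O}_K$ denotes the ring of algebraic integers in $K$. For a totally real algebraic integer $r$ and $t\in\mathbb{R}\cup\{+\infty\}$, write $0\ll r\ll t$ if every conjugate of $r$ over $\mathbb{Q}$ lies strictly between $0$ and $t$. Define $$A(\mathcal{O}_K)=\{t\in\mathbb{R}\cup\{+\infty\} : \text{there are infinitely many } r\in\mathcal{O}_K \text{ such that } 0\ll r\ll t\}.$$ *)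

(* Defs.v *)
From mathcomp Require Import all_boot all_order all_algebra.
From mathcomp Require Import complex.
From mathcomp Require Import boolp classical_sets cardinality reals constructive_ereal.
Set Implicit Arguments.
Unset Strict Implicit.
Unset Printing Implicit Defensive.
Import Order.TTheory GRing.Theory Num.Theory.

Local Open Scope ring_scope.
Local Open Scope complex_scope.
Local Open Scope classical_set_scope.

Section TotallyReal.
Variable R : realType.
Local Notation C := R[i].

(* z and w are roots of the same irreducible polynomial over the rationals,
   which is their minimal polynomial up to a scalar. *)
Definition conjugateQ (z w : C) : Prop :=
  exists p : {poly rat},
    [/\ irreducible_poly p, root (map_poly ratr p) z & root (map_poly ratr p) w].

Definition totally_real (z : C) : Prop :=
  forall w, conjugateQ z w -> w \is Num.real.

(* For a set of complex numbers, [divring_closed] says that it is a subfield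
   of the complex numbers, since [x / 0 = 0]. *)
Definition totally_real_field (K : set C) : Prop :=
  GRing.divring_closed [in K] /\
  forall z, K z -> algebraicOver (ratr : rat -> C) z /\ totally_real z.

Definition ring_of_integers (K : set C) : set C :=
  [set z | K z /\ integralOver (intr : int -> C) z].

(* The relation 0 << r << t. *)
Definition conjugates_between0 (r : C) (t : \bar R) : Prop :=
  forall w, conjugateQ r w -> exists2 x : R, w = x%:C & (0 < x%:E < t)%E.

(* The condition [t != -oo] makes this a subset of the reals with [+oo]. *)
Definition Aset (O : set C) : set (\bar R) :=
  [set t | t != -oo%E /\ infinite_set [set r | O r /\ conjugates_between0 r t]].

End TotallyReal.

(* Main.v *)
Require Import Defs.
From mathcomp Require Import all_boot all_order all_algebra all_field cyclic.
From mathcomp Require Import complex zify ring.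
From mathcomp Require Import boolp classical_sets cardinality reals constructive_ereal.

(** The fields are abelian. Let [P] be the set of primes [p > 7] modulo which
    some integer has multiplicative order three; prime divisors of values of
    [X^2 + X + 1] show that it is infinite. For a subset [S] of [P], let [K_S] be
    the field of all elements of cyclotomic fields that are fixed by the
    automorphisms raising roots of unity to a power [k] with [k ^ 6 = 1] modulo
    every [p] in [S].

    The exponent [-1] is among these, and it acts as complex conjugation on every
    conjugate because Galois groups of cyclotomic fields are abelian; so [K_S] is
    totally real ([fixed_field_conjugate]).

    For [p] in [S], the sum of [z ^ x] over the at most six [x] with [x ^ 6 = 1]
    modulo [p], where [z] is a primitive [p]-th root of unity, is an algebraic
    integer of [K_S] whose conjugates all lie between -6 and 6. These Gaussian
    periods are distinct since the period attached to [p] belongs to [K_S] only if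
    [p] is in [S] ([period_fixed_field]). Adding 7 to them shows that 14 is in
    [A(O_K)] when [S] is infinite, so [A(O_K)] is not reduced to [+oo].

    On the other hand, 4 is not in [A(O_K)]. By Kronecker's theorem ([Kronecker]) an
    integer with all its conjugates strictly between 0 and 4 is [2 + w + 1/w]
    with [w] a root of unity. If it lies in [K_S], then every allowed exponent must
    be [1] or [-1] modulo the order of [w]; but the Chinese remainder theorem gives
    an allowed exponent that differs from both modulo every prime power
    that does not divide 12 ([exists_wild_exponent]). Hence [w ^ 12 = 1], which
    leaves finitely many integers ([fixed_field_root_of_unity]).

    Removing one prime from [P] in all possible ways gives infinitely many fields,
    which are told apart by the periods that they contain.

    Automorphisms are replaced throughout by polynomials: an element is written
    [f(z)] with [f] rational and [z] a root of unity, and irreducibility of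
    cyclotomic polynomials says that a relation satisfied by [z] is satisfied by
    [z ^ k] for all [k] coprime to the order ([prim_root_conj]). *)

Set Implicit Arguments.
Unset Strict Implicit.
Unset Printing Implicit Defensive.
Import Order.TTheory GRing.Theory Num.Theory.
Local Open Scope ring_scope.
Local Open Scope classical_set_scope.

(** * Conjugates of a polynomial expression in a root of unity *)

Lemma closed_prim_root_exists (F : numClosedFieldType) n :
  (0 < n)%N -> exists z : F, n.-primitive_root z.
Proof.
move=> n_gt0; pose p : {poly F} := 'X^n - 1.
have [r Dp] := closed_field_poly_normal p.
rewrite (monicP _) ?monicXnsubC // scale1r in Dp.
have rn1: all n.-unity_root r by apply/allP=> z; rewrite -root_prod_XsubC -Dp.
have sz_r: (n < (size r).+1)%N.
  by rewrite -(size_prod_XsubC r id) -Dp size_XnsubC.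
have [|z] := hasP (has_prim_root n_gt0 rn1 _ sz_r); last by exists z.
by rewrite -separable_prod_XsubC -Dp separable_Xn_sub_1 // pnatr_eq0 -lt0n.
Qed.

Lemma map_Cyclotomic (F : numFieldType) n (z : F) :
  n.-primitive_root z -> map_poly intr 'Phi_n = cyclotomic z n.
Proof.
elim/ltn_ind: n z => n IHn z prim_z.
have n_gt0 := prim_order_gt0 prim_z.
have [uDn _ inDn] := divisors_correct n_gt0.
pose q := \prod_(d <- rem n (divisors n)) 'Phi_d.
have mon_q: q \is monic by apply: monic_prod => d _; apply: Cyclotomic_monic.
have nz_q: map_poly intr q != 0 :> {poly F}.
  by rewrite monic_neq0 ?monic_map.
apply: (mulIf nz_q).
transitivity ('X^n - 1 : {poly F}).
  rewrite -rmorphM /=.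
  have -> : 'Phi_n * q = 'X^n - 1.
    by rewrite -(prod_Cyclotomic n_gt0) (big_rem n) // inDn.
  by rewrite rmorphB rmorph1 /= map_polyXn.
rewrite (prod_cyclotomic prim_z) (big_rem n) ?inDn //=.
rewrite divnn n_gt0 rmorph_prod /=; congr (_ * _).
apply: eq_big_seq => d; rewrite mem_rem_uniq ?inE //= inDn => /andP[n'd ddvn].
by rewrite -IHn ?dvdn_prim_root // ltn_neqAle n'd dvdn_leq.
Qed.

Lemma map_poly_ratr_int (F : numFieldType) (p : {poly int}) :
  map_poly (ratr : rat -> F) (map_poly intr p) = map_poly intr p.
Proof.
rewrite -map_poly_comp; apply: eq_map_poly => b /=; exact: ratr_int.
Qed.

Lemma size_map_intr (F : numDomainType) (p : {poly int}) :
  size (map_poly (intr : int -> F) p) = size p.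
Proof. by apply: size_map_inj_poly => //; apply: intr_inj. Qed.

(** The irreducibility of the cyclotomic polynomial, stated without a choice
    of the ambient field: a proper factor would have a primitive root of unity
    among its complex roots, whose minimal polynomial is the whole of it. *)
Lemma Cyclotomic_dvdp (F : numFieldType) n (z : F) (g : {poly rat}) :
  n.-primitive_root z -> (map_poly ratr g).[z] = 0 ->
  map_poly intr 'Phi_n %| g.
Proof.
move=> prim_z gz0; have n_gt0 := prim_order_gt0 prim_z.
pose P : {poly rat} := map_poly intr 'Phi_n.
have nzP : P != 0 by rewrite monic_neq0 ?monic_map ?Cyclotomic_monic.
have [s d_split] := closed_field_poly_normal (map_poly (ratr : rat -> algC) (gcdp P g)).
have nzd : gcdp P g != 0 by rewrite gcdp_eq0 (negPf nzP).
have root_d : root (map_poly (ratr : rat -> F) (gcdp P g)) z.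
  rewrite gcdp_map root_gcd /P map_poly_ratr_int (map_Cyclotomic prim_z).
  by rewrite root_cyclotomic // prim_z /root gz0 eqxx.
have size_d : size (gcdp P g) != 1%N.
  apply/negP => /size_poly1P[c nzc Dc]; move: root_d.
  by rewrite Dc map_polyC rootC fmorph_eq0 (negPf nzc).
have [y d_y] : exists y, root (map_poly (ratr : rat -> algC) (gcdp P g)) y.
  by apply/closed_rootP; rewrite size_map_poly.
have [x prim_x] := C_prim_root_exists n_gt0.
have prim_y : n.-primitive_root y.
  move: d_y; rewrite gcdp_map root_gcd map_poly_ratr_int => /andP[+ _].
  by rewrite (map_Cyclotomic prim_x) root_cyclotomic.
have [p [Dp _] dv_p] := minCpolyP y.
have DP : P = p.
  apply: (map_poly_inj (ratr : {rmorphism rat -> algC})).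
  by rewrite /= -Dp map_poly_ratr_int (minCpoly_cyclotomic prim_y) (map_Cyclotomic prim_y).
rewrite -/P DP; move: d_y; rewrite dv_p => /dvdp_trans; apply.
exact: dvdp_gcdr.
Qed.

Lemma prim_root_conj (F : numFieldType) n (z : F) (g : {poly rat}) k :
  n.-primitive_root z -> coprime k n ->
  (map_poly ratr g).[z] = 0 -> (map_poly ratr g).[z ^+ k] = 0.
Proof.
move=> prim_z co_kn /(Cyclotomic_dvdp prim_z)/dvdpP[r ->].
apply/eqP; rewrite rmorphM /= map_poly_ratr_int hornerM mulf_eq0.
rewrite (map_Cyclotomic prim_z) [X in _ || X]root_cyclotomic //.
by rewrite prim_root_exp_coprime // co_kn orbT.
Qed.

Lemma prim_root_conj_eq (F : numFieldType) n (z : F) (g h : {poly rat}) k :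
  n.-primitive_root z -> coprime k n ->
  (map_poly ratr g).[z] = (map_poly ratr h).[z] ->
  (map_poly ratr g).[z ^+ k] = (map_poly ratr h).[z ^+ k].
Proof.
move=> prim_z co_kn /eqP; rewrite -subr_eq0 -hornerN -hornerD -rmorphB => /eqP.
move/(prim_root_conj prim_z co_kn)/eqP.
by rewrite rmorphB hornerD hornerN subr_eq0 => /eqP.
Qed.

Lemma eigenvalue_unitmx (F : fieldType) n (A : 'M[F]_n) w :
  eigenvalue A w = (A - w%:M \notin unitmx).
Proof. by rewrite /eigenvalue /eigenspace kermx_eq0 row_free_unit. Qed.

(** Over a closed field [f(X) - w] is a product of factors [X - m] with
    [f(m) = w], so if [f(A) - w] is singular then so is one of the [A - m]. *)
Lemma root_char_poly_horner_mx (F : closedFieldType) n (A : 'M[F]_n.+1)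
    (f : {poly F}) w :
  root (char_poly (horner_mx A f)) w ->
  exists2 m, root (char_poly A) m & w = f.[m].
Proof.
rewrite -eigenvalue_root_char eigenvalue_unitmx -(horner_mx_C A) -rmorphB /=.
have [f_w|nz_f] := eqVneq (f - w%:P) 0.
  have [m mA] : exists m, root (char_poly A) m.
    by apply/closed_rootP; rewrite size_char_poly.
  exists m => //; apply/eqP; rewrite eq_sym -subr_eq0.
  by rewrite -[w in _ - w](hornerC w m) -hornerN -hornerD f_w horner0.
have [s Ds] := closed_field_poly_normal (f - w%:P).
rewrite Ds linearZ /= unitmxZ ?unitfE ?lead_coef_eq0 // => not_unit.
have [m ms Am] : exists2 m, m \in s & root (char_poly A) m.
  apply/hasP/negPn; apply: contra not_unit => /hasPn no_eigen.
  elim: {Ds} s no_eigen => [|m s IHs] no_eigen.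
    by rewrite big_nil rmorph1 unitmx1.
  rewrite big_cons rmorphM /= unitmx_mul IHs ?andbT; last first.
    by move=> x xs; apply: no_eigen; rewrite inE xs orbT.
  have := no_eigen m (mem_head _ _).
  rewrite -eigenvalue_root_char eigenvalue_unitmx negbK.
  by rewrite rmorphB /= horner_mx_X horner_mx_C.
exists m => //; apply/eqP; rewrite eq_sym -subr_eq0.
rewrite -[w in _ - w](hornerC w m) -hornerN -hornerD Ds hornerZ.
by rewrite mulf_eq0 [X in _ || X]root_prod_XsubC ms orbT.
Qed.

Lemma char_poly_horner_mx_root (F : fieldType) n (A : 'M[F]_n.+1)
    (f : {poly F}) m :
  root (char_poly A) m -> root (char_poly (horner_mx A f)) f.[m].
Proof.
rewrite -!eigenvalue_root_char => /eigenvalueP[v vA nzv].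
apply/eigenvalueP; exists v => //; elim/poly_ind: f => [|f c IHf].
  by rewrite rmorph0 mulmx0 horner0 scale0r.
rewrite rmorphD rmorphM /= horner_mx_X horner_mx_C mulmxDr mulmxA IHf.
by rewrite -scalemxAl vA mul_mx_scalar hornerMXaddC scalerDl scalerA.
Qed.

Lemma monic_char_poly (R : comNzRingType) (P : {poly R}) :
  P \is monic -> (1 < size P)%N -> exists n (A : 'M[R]_n.+1), char_poly A = P.
Proof.
move=> monP szP; move: (companionmx P) (companionmxK monP).
case: (size P).-1 (@prednK (size P)) => [|n] Dsz A DA.
  by have sz1 := Dsz (ltnW szP); rewrite -sz1 in szP.
by exists n, A.
Qed.

(** Taking [Q] to be the characteristic polynomial of [f(A)], with [A] the companion
    matrix of [P], keeps its coefficients in [R] without any appeal to symmetric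
    functions. *)
Lemma transform_roots (R : comNzRingType) (F : closedFieldType)
    (g : {rmorphism R -> F}) (P f : {poly R}) :
  P \is monic -> (1 < size P)%N ->
  exists Q : {poly R}, [/\ Q \is monic, size Q = size P,
    forall m, root (map_poly g P) m -> root (map_poly g Q) (map_poly g f).[m] &
    forall w, root (map_poly g Q) w ->
      exists2 m, root (map_poly g P) m & w = (map_poly g f).[m]].
Proof.
move=> monP szP; have [n [A DP]] := monic_char_poly monP szP.
have DQ : map_poly g (char_poly (horner_mx A f))
    = char_poly (horner_mx (map_mx g A) (map_poly g f)).
  by rewrite map_char_poly map_horner_mx.
exists (char_poly (horner_mx A f)); split => [||m|w].
- exact: char_poly_monic.
- by rewrite -DP !size_char_poly.
- by rewrite DQ -DP map_char_poly; apply: char_poly_horner_mx_root.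
by rewrite DQ -DP map_char_poly; apply: root_char_poly_horner_mx.
Qed.

(** The polynomial [Q] is the characteristic polynomial over the rationals of
    multiplication by [f(z)] on the cyclotomic field of level [n]. *)
Lemma conjugates_prim_root (F : numClosedFieldType) n (z : F) (f : {poly rat}) :
  n.-primitive_root z ->
  exists Q : {poly rat}, [/\ Q != 0, root (map_poly ratr Q) (map_poly ratr f).[z] &
    forall w, root (map_poly ratr Q) w ->
      exists2 j, coprime j n & w = (map_poly ratr f).[z ^+ j]].
Proof.
move=> prim_z; have n_gt0 := prim_order_gt0 prim_z.
pose P : {poly rat} := map_poly intr 'Phi_n.
have monP : P \is monic by rewrite monic_map ?Cyclotomic_monic.
have szP : (1 < size P)%N.
  by rewrite size_map_intr size_Cyclotomic ltnS totient_gt0.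
have rootP m : root (map_poly (ratr : rat -> F) P) m = n.-primitive_root m.
  by rewrite map_poly_ratr_int (map_Cyclotomic prim_z) root_cyclotomic.
have [Q [monQ _ Q1 Q2]] :=
  transform_roots (ratr : {rmorphism rat -> F}) f monP szP.
exists Q; split => [||w /Q2[m]]; first exact: monic_neq0.
  by apply: Q1; rewrite rootP.
rewrite rootP => prim_m ->.
have [j Dm] := prim_rootP prim_z (prim_expr_order prim_m).
by exists j; rewrite -?Dm // -(prim_root_exp_coprime j prim_z) -Dm.
Qed.

Lemma irreducible_common_root (F : numFieldType) (p Q : {poly rat}) (x w : F) :
  irreducible_poly p -> root (map_poly ratr p) x -> root (map_poly ratr p) w ->
  root (map_poly ratr Q) x -> root (map_poly ratr Q) w.
Proof.
move=> [szp irrp] px pw Qx.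
have p_gcd : p %| gcdp p Q.
  rewrite -(eqp_dvdl _ (irrp (gcdp p Q) _ (dvdp_gcdl _ _))) //.
  apply/negP => /size_poly1P[c nzc Dc].
  have : root (map_poly (ratr : rat -> F) (gcdp p Q)) x by rewrite gcdp_map root_gcd px.
  by rewrite Dc map_polyC rootC fmorph_eq0 (negPf nzc).
have /dvdpP[r ->] := dvdp_trans p_gcd (dvdp_gcdr p Q).
by rewrite rmorphM rootM pw orbT.
Qed.

Lemma irreducible_conj_prim_root (F : numClosedFieldType) n (z : F)
    (f p : {poly rat}) w :
  n.-primitive_root z -> irreducible_poly p ->
  root (map_poly ratr p) (map_poly ratr f).[z] -> root (map_poly ratr p) w ->
  exists2 j, coprime j n & w = (map_poly ratr f).[z ^+ j].
Proof.
move=> prim_z irrp px pw; have [Q [_ Qx Qconj]] := conjugates_prim_root f prim_z.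
exact/Qconj/(irreducible_common_root irrp px pw Qx).
Qed.

(** * The fields fixed by the exponents of order dividing six *)

(** The exponents [k] for which [z -> z ^ k] on the [n]-th roots of unity is the
    restriction of an automorphism fixing the field attached to [S]. *)
Definition allowed_exponent (S : set nat) n k :=
  coprime k n /\ forall p, S p -> (p %| n)%N -> k ^ 6 = 1 %[mod p].

Lemma allowed_exponent_dvdn S m n k :
  (m %| n)%N -> allowed_exponent S n k -> allowed_exponent S m k.
Proof.
move=> m_n [co_kn Sk]; split; first exact: coprime_dvdr co_kn.
by move=> p Sp p_m; apply: Sk => //; apply: dvdn_trans m_n.
Qed.

Lemma allowed_exponent1 S n : allowed_exponent S n 1.
Proof. by split; rewrite ?coprime1n // => p _ _; rewrite exp1n. Qed.

Lemma sqrn_pred n : (0 < n)%N -> n.-1 ^ 2 = 1 %[mod n].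
Proof.
case: n => // -[|n] _ /=; first by rewrite !modn1.
have -> : (n.+1 ^ 2 = n * n.+2 + 1)%N by rewrite -mulnn; lia.
by rewrite modnMDl.
Qed.

Lemma allowed_exponent_pred S n : (0 < n)%N -> allowed_exponent S n n.-1.
Proof.
move=> n_gt0; split; first by case: n n_gt0 => // n _; apply: coprimenS.
move=> p _ p_n; rewrite -(modn_dvdm _ p_n) (expnM _ 2 3) -modnXm.
by rewrite sqrn_pred // modnXm exp1n modn_dvdm.
Qed.

Section FixedField.
Variable F : numClosedFieldType.
Implicit Types (S : set nat) (x y z w : F) (f g : {poly rat}).

Local Notation "f @[ x ]" := (map_poly (ratr : rat -> F) f).[x]
  (at level 2, format "f @[ x ]").

(** The exponent [1] being allowed, [x] is in particular [f(z)]. *)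
Definition fixed_field S : set F := [set x |
  exists n z f, n.-primitive_root z /\
    forall k, allowed_exponent S n k -> f@[z ^+ k] = x].

Lemma horner_comp_Xn f n x : (f \Po 'X^n)@[x] = f@[x ^+ n].
Proof. by rewrite map_comp_poly map_polyXn horner_comp hornerXn. Qed.

(** If [z] is the power [y ^+ i] of a primitive root of higher level, then
    composing [f] with ['X^i] raises the level of an expression [f(z)]. *)
Lemma fixed_field_level S x : fixed_field S x ->
  exists2 n, (0 < n)%N & forall m z, (n %| m)%N -> m.-primitive_root z ->
    exists f, forall k, allowed_exponent S m k -> f@[z ^+ k] = x.
Proof.
case=> n [z [f [prim_z fx]]]; exists n; first exact: prim_order_gt0 prim_z.
move=> m y n_m prim_y.
have [|i Dz] := prim_rootP prim_y (x := z).
  by have /dvdnP[q ->] := n_m; rewrite mulnC exprM (prim_expr_order prim_z) expr1n.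
exists (f \Po 'X^i) => k Sk.
rewrite horner_comp_Xn exprAC -Dz; apply: fx; exact: allowed_exponent_dvdn Sk.
Qed.

Lemma fixed_field_common_level S x y : fixed_field S x -> fixed_field S y ->
  exists n z f g, n.-primitive_root z /\
    forall k, allowed_exponent S n k -> f@[z ^+ k] = x /\ g@[z ^+ k] = y.
Proof.
move=> /fixed_field_level[m m_gt0 Fx] /fixed_field_level[n n_gt0 Fy].
have [z prim_z] : exists z : F, (m * n).-primitive_root z.
  by apply: closed_prim_root_exists; rewrite muln_gt0 m_gt0.
have [f fx] := Fx _ _ (dvdn_mulr _ (dvdnn m)) prim_z.
have [g gy] := Fy _ _ (dvdn_mull _ (dvdnn n)) prim_z.
by exists (m * n)%N, z, f, g; split => // k Sk; rewrite fx ?gy.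
Qed.

(** Membership does not depend on the expression chosen for [x]: at a common
    level, two polynomials with the same value at a primitive root have the same
    value at all its conjugates. *)
Lemma fixed_field_expr S x n y g : fixed_field S x -> (0 < n)%N ->
  y ^+ n = 1 -> g@[y] = x ->
  exists m, [/\ (0 < m)%N, (n %| m)%N &
    forall k, allowed_exponent S m k -> g@[y ^+ k] = x].
Proof.
move=> /fixed_field_level[m m_gt0 Fx] n_gt0 yn1 gx.
have [z prim_z] : exists z : F, (m * n).-primitive_root z.
  by apply: closed_prim_root_exists; rewrite muln_gt0 m_gt0.
have [f fx] := Fx _ _ (dvdn_mulr _ (dvdnn m)) prim_z.
have [|i Dy] := prim_rootP prim_z (x := y).
  by rewrite mulnC exprM yn1 expr1n.
exists (m * n)%N; split; [by rewrite muln_gt0 m_gt0| exact: dvdn_mull|].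
move=> k Sk; rewrite Dy exprAC -horner_comp_Xn -(fx _ Sk).
apply: prim_root_conj_eq prim_z Sk.1 _.
by rewrite horner_comp_Xn -Dy gx -[z]expr1 fx //; apply: allowed_exponent1.
Qed.

(** The inverse of [f(z)] is the value at [z] of a Bezout cofactor of [f] with
    respect to the cyclotomic polynomial. *)
Lemma prim_root_inverse n z f : n.-primitive_root z -> f@[z] != 0 ->
  exists g, forall k, coprime k n -> g@[z ^+ k] = (f@[z ^+ k])^-1.
Proof.
move=> prim_z fz; pose P : {poly rat} := map_poly intr 'Phi_n.
have rootP k : coprime k n -> P@[z ^+ k] = 0.
  move=> co_kn; apply/eqP; rewrite map_poly_ratr_int (map_Cyclotomic prim_z).
  by rewrite [_ == 0]root_cyclotomic // prim_root_exp_coprime.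
have size_gcd : size (gcdp f P) = 1%N.
  apply/eqP/negPn/negP => gcd1.
  have [t] : exists t, root (map_poly (ratr : rat -> F) (gcdp f P)) t.
    by apply/closed_rootP; rewrite size_map_poly.
  rewrite gcdp_map root_gcd map_poly_ratr_int => /andP[ft].
  rewrite (map_Cyclotomic prim_z) root_cyclotomic // => prim_t.
  have /dvdpP[r Df] := Cyclotomic_dvdp prim_t (eqP ft).
  case/negP: fz; rewrite Df rmorphM hornerM -/P.
  by have /= -> := rootP 1%N (coprime1n n); rewrite ?mulr0.
have /Bezout_eq1_coprimepP[[u v] /= Duv] : coprimep f P by rewrite /coprimep size_gcd.
exists u => k co_kn.
have := congr1 (fun p => p@[z ^+ k]) Duv.
rewrite rmorphD !rmorphM rmorph1 /= !hornerE rootP // mulr0 addr0 => ufz.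
have nz_fz : f@[z ^+ k] != 0 by apply: contra_eq_neq ufz => ->; rewrite mulr0 eq_sym oner_eq0.
by apply: (mulIf nz_fz); rewrite ufz mulVf.
Qed.

Lemma fixed_field_sub S x y :
  fixed_field S x -> fixed_field S y -> fixed_field S (x - y).
Proof.
move=> Kx Ky; have [n [z [f [g [prim_z fg]]]]] := fixed_field_common_level Kx Ky.
exists n, z, (f - g); split=> // k /fg[<- <-].
by rewrite rmorphB hornerD hornerN.
Qed.

Lemma fixed_field_div S x y :
  fixed_field S x -> fixed_field S y -> fixed_field S (x / y).
Proof.
move=> Kx Ky; have [n [z [f [g [prim_z fg]]]]] := fixed_field_common_level Kx Ky.
have [-> | nz_y] := eqVneq y 0.
  by exists n, z, 0; split=> // k _; rewrite rmorph0 horner0 invr0 mulr0.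
have [_ gz] := fg _ (allowed_exponent1 S n).
have [|h hP] := @prim_root_inverse n z g prim_z; first by rewrite -[z]expr1 gz.
exists n, z, (f * h); split=> // k Sk; have [<- <-] := fg k Sk.
by rewrite rmorphM hornerM hP //; case: Sk.
Qed.

Lemma fixed_field_divring_closed S : GRing.divring_closed [in fixed_field S].
Proof.
split=> [|x y|x y]; rewrite !inE.
- have [//|z prim_z] := @closed_prim_root_exists F 1.
  by exists 1%N, z, 1; split=> // k _; rewrite rmorph1 hornerC.
- exact: fixed_field_sub.
exact: fixed_field_div.
Qed.

(** The exponent [-1] is allowed, and since cyclotomic fields are abelian it acts
    as complex conjugation on all the conjugates at once. *)
Lemma fixed_field_conj_real S n z f j : n.-primitive_root z -> coprime j n ->
  (forall k, allowed_exponent S n k -> f@[z ^+ k] = f@[z]) ->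
  f@[z ^+ j] \is Num.real.
Proof.
move=> prim_z co_jn fz; have n_gt0 := prim_order_gt0 prim_z.
have fzj : f@[(z ^+ j) ^+ n.-1] = f@[z ^+ j].
  rewrite -horner_comp_Xn; apply: (prim_root_conj_eq prim_z co_jn).
  by rewrite horner_comp_Xn fz //; apply: allowed_exponent_pred.
have norm_z : `|z ^+ j| = 1.
  apply/eqP; rewrite -(pexpr_eq1 n_gt0) // -normrX exprAC.
  by rewrite (prim_expr_order prim_z) expr1n normr1.
have nz_zj : z ^+ j != 0 by rewrite -normr_eq0 norm_z oner_eq0.
have zj_conj : (z ^+ j)^* = (z ^+ j) ^+ n.-1.
  transitivity ((z ^+ j)^-1); first by rewrite invC_norm norm_z expr1n invr1 mul1r.
  apply: (mulfI nz_zj); rewrite divff // -exprS prednK // exprAC.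
  by rewrite (prim_expr_order prim_z) expr1n.
apply/CrealP; rewrite -horner_map /= zj_conj -map_poly_comp.
rewrite (eq_map_poly (g := ratr)) // => a; exact: fmorph_rat.
Qed.

Lemma fixed_field_conjugate S x : fixed_field S x ->
  (exists2 Q : {poly rat}, Q != 0 & root (map_poly ratr Q) x) /\
  forall (p : {poly rat}) w, irreducible_poly p -> root (map_poly ratr p) x ->
    root (map_poly ratr p) w -> w \is Num.real.
Proof.
case=> n [z [f [prim_z fx]]].
have fz : f@[z] = x by rewrite -[z]expr1; apply: fx; exact: allowed_exponent1.
split; first by have [Q [nzQ Qx _]] := conjugates_prim_root f prim_z; exists Q; rewrite -?fz.
move=> p w irrp px pw; rewrite -fz in px.
have [j co_jn ->] := irreducible_conj_prim_root prim_z irrp px pw.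
by apply: (fixed_field_conj_real (S := S) prim_z co_jn) => k Sk; rewrite fz fx.
Qed.

End FixedField.

(** * Roots of unity whose real parts lie in a fixed field *)

(** A root [g] of [X^2 + X + 1] has order three modulo [p], so that it is a sixth
    root of unity other than [1] and [-1]. The bound on [p] excludes the prime
    divisors 3 and 7 of [2 ^ 6 - 1], so that 2 is not a sixth root of unity. *)
Definition cubic_prime p := prime p /\ (7 < p)%N /\ exists g, (p %| g ^ 2 + g + 1)%N.

Lemma exponent_crt (a : nat -> nat) n : (0 < n)%N ->
  exists k, forall q, prime q -> k = a q %[mod q ^ logn q n].
Proof.
move=> n_gt0.
suff [k Pk] : exists k, {in primes n, forall q, k = a q %[mod q ^ logn q n]}.
  exists k => q q_pr; have [qn|] := boolP (q \in primes n); first exact: Pk.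
  by rewrite -logn_gt0 -eqn0Ngt => /eqP ->; rewrite !modn1.
have : all prime (primes n) by apply/allP => q; rewrite mem_primes => /andP[].
elim: (primes n) (primes_uniq n) => [|q s IHs] /= => [_ _|/andP[q_s /IHs{}IHs]].
  by exists 0%N.
case/andP=> q_pr s_pr; have [k Pk] := IHs s_pr.
pose m := (\prod_(r <- s) r ^ logn r n)%N.
have co_qm : coprime (q ^ logn q n) m.
  rewrite coprimeXl // /m big_seq_cond; elim/big_ind: _ => [|x y cx cy|r].
  - exact: coprimen1.
  - by rewrite coprimeMr cx.
  rewrite andbT => rs; rewrite coprimeXr // prime_coprime // dvdn_prime2 //.
    by apply: contraNneq q_s => ->.
  exact: (allP s_pr).
exists (chinese (q ^ logn q n) m (a q) k) => r; rewrite inE => /predU1P[-> | rs].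
  exact: chinese_modl.
have r_m : (r ^ logn r n %| m)%N by rewrite /m (big_rem r) //= dvdn_mulr.
by rewrite -(modn_dvdm _ r_m) chinese_modr // modn_dvdm // Pk.
Qed.

Lemma sixth_power_order3 p k : (p %| k ^ 2 + k + 1)%N -> k ^ 6 = 1 %[mod p].
Proof.
case: k => [|k] pk.
  by rewrite dvdn1 in pk; rewrite (eqP pk) !modn1.
have -> : (k.+1 ^ 6 = (k * (k.+1 ^ 3 + 1)) * (k.+1 ^ 2 + k.+1 + 1) + 1)%N.
  by rewrite -[k.+1]addn1; ring.
have /dvdnP[m ->] := pk; by rewrite mulnA modnMDl.
Qed.

Lemma eqmod_quadratic q a b :
  a = b %[mod q] -> a ^ 2 + a + 1 = b ^ 2 + b + 1 %[mod q].
Proof.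
move=> ab; have ab2 : a ^ 2 = b ^ 2 %[mod q] by rewrite -modnXm ab modnXm.
by rewrite -(modnDml (a ^ 2 + a)) -(modnDm (a ^ 2) a) ab2 ab modnDm modnDml.
Qed.

(** The primes outside [S] put no condition on allowed exponents, and at those of
    [S] an element of order three is allowed; the Chinese remainder theorem
    combines these local choices. *)
Lemma exists_wild_exponent S n : (forall p, S p -> cubic_prime p) -> (0 < n)%N ->
  exists2 k, allowed_exponent S n k & forall q e, prime q -> (q ^ e %| n)%N ->
    if `[< S q >] then (0 < e)%N -> (q %| k ^ 2 + k + 1)%N
    else k = (if q == 2%N then 3 else 2) %[mod q ^ e].
Proof.
move=> S_cubic n_gt0.
have /choice[g Pg] : forall q, exists m, S q -> (q %| m ^ 2 + m + 1)%N.
  move=> q; have [Sq|nSq] := pselect (S q); last by exists 0%N.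
  by have [_ [_ [m Pm]]] := S_cubic q Sq; exists m.
(* At [q = 2] the exponent must be odd, and 3 differs from 1 and -1 modulo 8. At
   the odd primes outside [S], 2 differs from 1 and -1 except modulo 3. *)
pose a q := if `[< S q >] then g q else if q == 2%N then 3 else 2.
have [k Pk] := exponent_crt a n_gt0.
have Dk q e : prime q -> (q ^ e %| n)%N -> k = a q %[mod q ^ e].
  move=> q_pr; rewrite pfactor_dvdn // => le_e.
  by rewrite -(modn_dvdm _ (dvdn_exp2l q le_e)) Pk // modn_dvdm // dvdn_exp2l.
have Sk q : S q -> prime q -> (q %| n)%N -> (q %| k ^ 2 + k + 1)%N.
  move=> Sq q_pr; rewrite -{1}(expn1 q) => /(Dk q 1%N q_pr).
  rewrite expn1 /a asboolT // => Ekg.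
  by have := Pg q Sq; rewrite /dvdn (eqmod_quadratic Ekg).
exists k; last first.
  move=> q e q_pr qe_n; case: asboolP => [Sq e_gt0|nSq].
    by apply: Sk => //; apply: dvdn_trans qe_n; apply: dvdn_exp.
  by rewrite Dk // /a asboolF.
split; last by move=> q Sq q_n; apply/sixth_power_order3/Sk => //; have [] := S_cubic q Sq.
apply/negPn/negP => not_co.
have gcd_gt1 : (1 < gcdn k n)%N.
  by rewrite ltn_neqAle eq_sym not_co gcdn_gt0 n_gt0 orbT.
have q_pr := pdiv_prime gcd_gt1; have := pdiv_dvd (gcdn k n).
move: (pdiv _) q_pr => q q_pr; rewrite dvdn_gcd => /andP[q_k q_n].
have [Sq|nSq] := pselect (S q).
  have := Sk q Sq q_pr q_n; rewrite dvdn_addr ?Euclid_dvd1 //.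
  by rewrite dvdn_add // dvdn_exp.
have := Dk q 1%N q_pr; rewrite expn1 => /(_ q_n)/eqP.
rewrite /a asboolF // eq_sym (eqP (q_k : k %% q == 0)%N) => q_a.
have {q_a} : (q %| if q == 2 then 3 else 2)%N by [].
by case: eqVneq => [-> //|q2]; rewrite dvdn_prime2 // (negPf q2).
Qed.

(** The exponent [k] moves [w + 1/w] unless it is [1] or [-1] modulo the order of
    [w]; the exponent just found is neither at any prime power not dividing 12. *)
Lemma fixed_field_root_of_unity (F : numClosedFieldType) S n (w : F) :
  (forall p, S p -> cubic_prime p) -> (0 < n)%N -> w ^+ n = 1 ->
  fixed_field S (w + w^-1) -> w ^+ 12 = 1.
Proof.
move=> S_cubic n_gt0 wn1 Kw.
have [{wn1 n_gt0}d prim_w _] := prim_order_exists n_gt0 wn1.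
have d_gt0 := prim_order_gt0 prim_w.
have nz_w : w != 0 by rewrite (prim_root_eq0 prim_w) -lt0n.
have winv : w ^+ d.-1 = w^-1.
  by apply: (mulfI nz_w); rewrite -exprS prednK // (prim_expr_order prim_w) divff.
pose g : {poly rat} := 'X + 'X^(d.-1).
have gE x : (map_poly (ratr : rat -> F) g).[x] = x + x ^+ d.-1.
  by rewrite rmorphD /= map_polyX map_polyXn hornerD hornerX hornerXn.
have [|m [m_gt0 d_m gw]] := fixed_field_expr (g := g) Kw d_gt0 (prim_expr_order prim_w).
  by rewrite gE winv.
have [k /gw + Wk] := exists_wild_exponent S_cubic m_gt0.
rewrite gE exprAC winv exprVn => wk.
(* The equation [t + 1/t = w + 1/w] forces [t] to be [w] or [1/w]. *)
have k1 : (k == 1 %[mod d]) || (k + 1 == 0 %[mod d]).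
  rewrite -!(eq_prim_root_expr prim_w) expr1 exprD expr0 expr1.
  have nz_wk : w ^+ k != 0 by rewrite expf_neq0.
  have : (w ^+ k - w) * (w ^+ k * w - 1) = 0.
    transitivity ((w ^+ k + (w ^+ k)^-1 - (w + w^-1)) * w ^+ k * w).
      by field; rewrite nz_w nz_wk.
    by rewrite wk subrr !mul0r.
  by move/eqP; rewrite mulf_eq0 !subr_eq0.
apply/eqP; rewrite -(prim_order_dvd prim_w); apply/dvdn_partP => // q.
rewrite mem_primes => /and3P[q_pr _ q_d].
rewrite p_part; set e := logn q d.
have e_gt0 : (0 < e)%N by rewrite logn_gt0 mem_primes q_pr d_gt0.
have qe_d : (q ^ e %| d)%N by apply: pfactor_dvdnn.
have := Wk q e q_pr (dvdn_trans qe_d d_m).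
case: asboolP => [Sq /(_ e_gt0) q_k|nSq Ek].
  have [_ [q_gt7 _]] := S_cubic q Sq; exfalso.
  case/orP: k1 => /eqP /(congr1 (modn^~ q)); rewrite !modn_dvdm // => Ek.
    have : (q %| 3)%N; last by move/dvdn_leq => /(_ isT); lia.
    by move: q_k; rewrite /dvdn (eqmod_quadratic Ek).
  have q_k1 : (q %| k + 1)%N by rewrite /dvdn Ek mod0n.
  have : (q %| 1)%N; last by move/dvdn_leq => /(_ isT); lia.
  by move: q_k; rewrite dvdn_addr // -mulnn -mulnSr -addn1 dvdn_mull.
set c := (if _ then _ else _) in Ek.
have : (q ^ e %| c - 1)%N || (q ^ e %| c + 1)%N.
  case/orP: k1 => /eqP /(congr1 (modn^~ (q ^ e)%N)); rewrite !modn_dvdm // => Ek1.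
    by rewrite -eqn_mod_dvd ?/c -?Ek ?Ek1 ?eqxx //; case: ifP.
  by rewrite orbC /dvdn -modnDml -Ek modnDml Ek1 mod0n.
rewrite /c; case: eqP => _ /orP[] /dvdn_trans; exact.
Qed.

(** * Gaussian periods *)

(** A prime divisor of [a ^ 2 + a + 1] is coprime to [a], so it is large if [a] is
    a factorial. *)
Lemma exists_cubic_prime n : exists2 p, (n < p)%N & cubic_prime p.
Proof.
pose a := (n + 7)`!; pose p := pdiv (a ^ 2 + a + 1).
have p_pr : prime p by rewrite pdiv_prime // addn1 ltnS addn_gt0 fact_gt0 orbT.
have p_a : (p %| a ^ 2 + a + 1)%N by apply: pdiv_dvd.
have np : (n + 7 < p)%N.
  rewrite ltnNge; apply/negP => le_p.
  have pa : (p %| a)%N by rewrite dvdn_fact // prime_gt0.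
  by move: p_a; rewrite dvdn_addr ?Euclid_dvd1 // dvdn_add // dvdn_exp.
exists p; first by apply: leq_ltn_trans np; apply: leq_addr.
by split=> //; split; [apply: leq_ltn_trans np; apply: leq_addl | exists a].
Qed.

(** Its value at a primitive [p]-th root of unity is the Gaussian period attached
    to the group of sixth roots of unity modulo [p]. *)
Definition period_poly p : {poly rat} := \sum_(x : 'F_p | x ^+ 6 == 1) 'X^x.

Section Period.
Variables (F : numClosedFieldType) (p : nat).
Hypothesis p_pr : prime p.
Implicit Types (z : F) (S : set nat).

Local Notation eta z := (map_poly (ratr : rat -> F) (period_poly p)).[z].

Lemma periodE z : eta z = \sum_(x : 'F_p | x ^+ 6 == 1) z ^+ x.
Proof.
rewrite rmorph_sum horner_sum /=; apply: eq_bigr => x _.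
by rewrite map_polyXn hornerXn.
Qed.

Lemma Fp_expr_mul z k (x : 'F_p) :
  z ^+ p = 1 -> z ^+ (k%:R * x : 'F_p)%R = (z ^+ k) ^+ x.
Proof.
move=> zp1; rewrite -[x in (k%:R * x)%R]natr_Zp -natrM val_Fp_nat //.
by rewrite expr_mod // exprM.
Qed.

Lemma period_exponent z k : z ^+ p = 1 -> k ^ 6 = 1 %[mod p] -> eta (z ^+ k) = eta z.
Proof.
move=> zp1 k6; have k6F : k%:R ^+ 6 = 1 :> 'F_p.
  by rewrite -natrX; apply: val_inj; rewrite /= !val_Fp_nat // k6 -val_Fp_nat.
have nz_k : k%:R != 0 :> 'F_p.
  by apply: contra_eq_neq k6F => ->; rewrite expr0n eq_sym oner_eq0.
rewrite !periodE [RHS](reindex_inj (mulfI nz_k)) /=.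
apply: eq_big => x; first by rewrite exprMn k6F mul1r.
by rewrite Fp_expr_mul.
Qed.

(** Dividing [g] by ['X] leaves a polynomial of degree less than [p.-1], the degree
    of the cyclotomic polynomial. *)
Lemma prime_root_free z (g : {poly rat}) : p.-primitive_root z ->
  (size g <= p)%N -> g`_0 = 0 -> (map_poly ratr g).[z] = 0 -> g = 0.
Proof.
move=> prim_z le_gp g0 gz.
have /factor_theorem[h Dg] : root g 0 by rewrite /root horner_coef0 g0.
rewrite subr0 in Dg.
have nz_z : z != 0 by rewrite (prim_root_eq0 prim_z) -lt0n prime_gt0.
have hz : (map_poly ratr h).[z] = 0.
  apply/eqP; move/eqP: gz; rewrite Dg rmorphM hornerM /= map_polyX hornerX.
  by rewrite mulf_eq0 (negPf nz_z) orbF.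
have [h0|nz_h] := eqVneq h 0; first by rewrite Dg h0 mul0r.
have := dvdp_leq nz_h (Cyclotomic_dvdp prim_z hz).
rewrite size_map_intr size_Cyclotomic totient_prime // prednK ?prime_gt0 //.
move: le_gp; rewrite Dg size_mulX // => le1 le2.
by have := leq_trans le1 le2; rewrite ltnn.
Qed.

(** Otherwise the two sums of powers of [z] would agree term by term, and 2 would
    be a sixth root of unity modulo [p], so that [p] would divide 63. *)
Lemma period_moved z : p.-primitive_root z -> (7 < p)%N -> eta (z ^+ 2) <> eta z.
Proof.
move=> prim_z p_gt7 eta2; have zp1 := prim_expr_order prim_z.
pose f2 : {poly rat} := \sum_(x : 'F_p | x ^+ 6 == 1) 'X^((2%:R * x)%R : 'F_p).
have f2E : (map_poly ratr f2).[z] = eta (z ^+ 2).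
  rewrite periodE rmorph_sum horner_sum /=; apply: eq_bigr => x _.
  by rewrite map_polyXn hornerXn -Fp_expr_mul.
have two_neq0 : 2%:R != 0 :> 'F_p.
  by rewrite -(dvdn_pcharf (pchar_Fp p_pr)) dvdn_prime2 //; lia.
have size_le (h : 'F_p -> 'F_p) :
    (size (\sum_(x : 'F_p | x ^+ 6 == 1) 'X^(h x) : {poly rat})%R <= p)%N.
  apply: leq_trans (size_sum _ _ _) _; apply/bigmax_leqP => x _.
  by rewrite size_polyXn -[X in (_ < X)%N](Fp_cast p_pr) ltn_ord.
have coef0 (h : 'F_p -> 'F_p) : (forall x, x != 0 -> h x != 0) ->
    (\sum_(x : 'F_p | x ^+ 6 == 1) 'X^(h x) : {poly rat})`_0 = 0.
  move=> nz_h; rewrite coef_sum big1 // => x /eqP x6; rewrite coefXn.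
  case: eqP => // hx; have nz_x : x != 0.
    by apply: contra_eq_neq x6 => ->; rewrite expr0n eq_sym oner_eq0.
  by case/negP: (nz_h x nz_x); apply/eqP/val_inj; rewrite /= -hx.
have /eqP : f2 - period_poly p = 0.
  apply: prime_root_free prim_z _ _ _.
  - by rewrite (leq_trans (size_polyD _ _)) // geq_max size_polyN !size_le.
  - by rewrite coefB !coef0 ?subrr // => x nz_x; rewrite mulf_neq0.
  by rewrite rmorphB hornerD hornerN f2E eta2 subrr.
(* The coefficient of ['X] is 1 in [period_poly p], and it is nonzero in [f2] only
   if the inverse of 2 is a sixth root of unity. *)
rewrite subr_eq0 => /eqP/(congr1 (fun f : {poly rat} => f`_1)).
rewrite !coef_sum [RHS](bigD1 1) ?expr1n //= coefXn eqxx.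
have [x /andP[/eqP x6 /eqP x1] _|no_x] :=
  pickP (fun x : 'F_p => (x ^+ 6 == 1) && (1%N == ((2%:R * x)%R : 'F_p) :> nat)).
  have xE : 2%:R * x = 1 by apply: val_inj.
  have : 2%:R ^+ 6 == 1 :> 'F_p by rewrite -[_ ^+ 6]mulr1 -[X in _ * X]x6 -exprMn xE expr1n.
  rewrite -natrX -subr_eq0 -(natrB _ (_ : 1 <= 2 ^ 6)%N) //.
  rewrite -(dvdn_pcharf (pchar_Fp p_pr)) (_ : (2 ^ 6 - 1 = 3 * 3 * 7)%N) //.
  by rewrite !Euclid_dvdM // => /orP[/orP[]|] /dvdn_leq => /(_ isT); lia.
rewrite big1 => [|x x6]; last by have := no_x x; rewrite x6 coefXn /= => ->.
move/eqP; rewrite eq_sym paddr_eq0 ?oner_eq0 //.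
by apply: sumr_ge0 => x _; rewrite coefXn ler0n.
Qed.

Lemma period_norm z : `|z| = 1 -> `|eta z| <= 6%:R.
Proof.
move=> z1; rewrite periodE (le_trans (ler_norm_sum _ _ _)) //.
rewrite (eq_bigr (fun=> 1)) => [|x _]; last by rewrite normrX z1 expr1n.
rewrite sumr_const ler_nat cardE; apply: max_unity_roots => //.
  by apply/allP => x; rewrite mem_enum => x6; apply/unity_rootP/eqP.
exact: enum_uniq.
Qed.

Lemma period_integral z : z ^+ p = 1 -> integralOver (intr : int -> F) (eta z).
Proof.
move=> zp1; rewrite periodE; elim/big_ind: _ => [|x y|x _].
- exact: (integral_nat _ 0).
- exact: integral_add.
elim: (nat_of_ord x) => [|n IHn]; first exact: (integral_nat _ 1).
rewrite exprS; apply: integral_mul IHn.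
exists ('X^p - 1); first by rewrite monicXnsubC ?prime_gt0.
by rewrite rmorphB rmorph1 /= map_polyXn /root !hornerE zp1 subrr.
Qed.

(** If [p] is outside [S], then some allowed exponent is 2 modulo [p], and it moves
    the period. *)
Lemma period_fixed_field S z : (forall q, S q -> cubic_prime q) -> (7 < p)%N ->
  p.-primitive_root z -> fixed_field S (eta z) <-> S p.
Proof.
move=> S_cubic p_gt7 prim_z; have zp1 := prim_expr_order prim_z.
split=> [Kz|Sp]; last first.
  exists p, z, (period_poly p); split=> // k [_ Sk].
  by apply: period_exponent => //; apply: Sk.
have [m [m_gt0 p_m fz]] := fixed_field_expr Kz (prime_gt0 p_pr) zp1 erefl.
have [k /fz eta_k /(_ p 1%N p_pr)] := exists_wild_exponent S_cubic m_gt0.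
rewrite expn1 => /(_ p_m); case: asboolP => // _.
rewrite gtn_eqF ?(ltn_trans _ p_gt7) // => k2.
case: (period_moved prim_z p_gt7); rewrite -eta_k; congr (eta _).
by rewrite -(expr_mod k zp1) k2 expr_mod.
Qed.

End Period.

(** * Kronecker's theorem on integers with conjugates in [-2, 2] *)

(** A monic integer polynomial of least degree among those vanishing at [r] is
    irreducible over the rationals by Gauss's lemma. *)
Lemma integral_minimal_polynomial (F : numFieldType) (r : F) :
  integralOver (intr : int -> F) r ->
  exists P : {poly int}, [/\ P \is monic, root (map_poly intr P) r &
    irreducible_poly (map_poly (intr : int -> rat) P)].
Proof.
case=> P0 monP0 P0r.
pose has_size n := `[< exists P : {poly int},
  [/\ P \is monic, root (map_poly (intr : int -> F) P) r & size P = n] >].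
have ex_size : exists n, has_size n by exists (size P0); apply/asboolP; exists P0.
case: (ex_minnP ex_size) => n /asboolP[P [monP Pr szP]] minP.
exists P; split=> //; split.
  rewrite size_map_intr ltnNge; apply/negP => /size1_polyC DP.
  move: monP Pr; rewrite DP monicE lead_coefC => /eqP ->.
  by rewrite rmorph1 rootC oner_eq0.
move=> q szq /dvdpP_rat_int[f [a nz_a Dq] [g Dfg]].
rewrite Dq size_scale // size_map_intr in szq.
(* The leading coefficients of [f] and [g] are inverse units of the integers. *)
wlog [monf mong] : a f g nz_a Dfg Dq szq / f \is monic /\ g \is monic.
  move=> IH; pose cf := lead_coef f; pose cg := lead_coef g.
  have cfg1 : cf * cg = 1 by rewrite -lead_coefM -Dfg (monicP monP).
  have nz_cf : cf != 0 by apply: contra_eq_neq cfg1 => ->; rewrite mul0r eq_sym oner_eq0.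
  apply: (IH (a * cf%:~R) (cg *: f) (cf *: g)).
  - by rewrite mulf_neq0 // intr_eq0.
  - by rewrite -scalerAl -scalerAr scalerA mulrC cfg1 scale1r.
  - by rewrite map_polyZ scalerA -mulrA -intrM cfg1 mulr1.
  - by rewrite size_scale //; apply: contra_eq_neq cfg1 => ->; rewrite mulr0 eq_sym oner_eq0.
  by rewrite !monicE !lead_coefZ -/cf -/cg (mulrC cg) cfg1.
have szfg : (size f + size g = (size P).+1)%N.
  rewrite Dfg size_Mmonic ?monic_neq0 // prednK // addn_gt0 size_poly_gt0.
  by rewrite monic_neq0.
have f_gt1 : (1 < size f)%N.
  by rewrite ltn_neqAle eq_sym szq size_poly_gt0 monic_neq0.
have fr : root (map_poly (intr : int -> F) f) r.
  move: Pr; rewrite Dfg rmorphM rootM => /orP[] // gr.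
  have /minP : has_size (size g) by apply/asboolP; exists g.
  by rewrite -szP => le_Pg; exfalso; lia.
have /minP : has_size (size f) by apply/asboolP; exists f.
rewrite -szP => le_Pf.
have g_gt0 : (0 < size g)%N by rewrite size_poly_gt0 monic_neq0.
have g_1 : size g = 1%N by lia.
have Dg : g = 1.
  move/eqP: g_1 => /size_poly1P[c _ Dg]; move: mong.
  by rewrite Dg monicE lead_coefC => /eqP ->.
by rewrite Dq Dfg Dg mulr1 eqp_scale.
Qed.

(** Each factor multiplies the bound on the coefficients by at most [B.+1]. *)
Lemma coef_prod_XsubC_bound (F : numFieldType) (B : nat) (s : seq F) i :
  {in s, forall a, `|a| <= B%:R} ->
  `|(\prod_(a <- s) ('X - a%:P))`_i| <= B.+1%:R ^+ size s.
Proof.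
elim: s i => [|a s IHs] i sB.
  rewrite big_nil coef1 expr0; case: (i == 0%N); by rewrite ?normr1 ?normr0.
have {}IHs j : `|(\prod_(a <- s) ('X - a%:P))`_j| <= B.+1%:R ^+ size s.
  by apply: IHs => b bs; apply: sB; rewrite inE bs orbT.
rewrite big_cons mulrBl coefB coefXM coefCM /= exprS -natr1 mulrDl mul1r.
rewrite (le_trans (ler_normB _ _)) // natr1 addrC lerD //.
  by rewrite normrM ler_pM ?sB ?mem_head.
by case: (i == 0%N); rewrite ?normr0 ?exprn_ge0 ?ler0n.
Qed.

Lemma finite_bounded_int_poly (n M : nat) :
  finite_set [set P : {poly int} | (size P <= n)%N /\ forall i, `|P`_i| <= M%:Z].
Proof.
(* The coefficients are shifted by [M] to fit in an initial segment of the natural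
   numbers. *)
pose f (u : {ffun 'I_n -> 'I_(2 * M).+1}) : {poly int} :=
  \poly_(i < n) (if insub i is Some j then (u j)%:Z - M%:Z else 0).
apply: sub_finite_set (finite_image f (finite_finset (X := setT))) => P /= [szP PM].
exists [ffun i : 'I_n => inord (absz (P`_i + M%:Z))] => //.
apply/polyP => i; rewrite coef_poly; case: ltnP => [lt_in|le_ni]; last first.
  by rewrite nth_default // (leq_trans szP).
rewrite insubT ffunE /= inordK; have := PM i; lia.
Qed.

(** The bounded monic integer polynomials of a given degree have bounded
    coefficients, hence are finite in number, and so are their roots. *)
Lemma finite_bounded_integers (F : numClosedFieldType) (n B : nat) :
  finite_set [set x : F | exists P : {poly int}, [/\ P \is monic, size P = n,
    root (map_poly intr P) x &
    forall y : F, root (map_poly intr P) y -> `|y| <= B%:R]].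
Proof.
pose A := [set P : {poly int} | (size P <= n)%N /\
  forall i, `|P`_i| <= (B.+1 ^ n.-1)%N%:Z].
apply: (@sub_finite_set _ _ (\bigcup_(P in A `&` [set P | P \is monic])
    [set x : F | root (map_poly intr P) x])).
  move=> x /= [P [monP szP Px PB]]; exists P => //; split=> //.
  split=> [|i]; first by rewrite szP.
  have [s Ds] := closed_field_poly_normal (map_poly (intr : int -> F) P).
  rewrite (monicP (monic_map _ monP)) scale1r in Ds.
  have szs : size s = n.-1.
    by have := size_prod_XsubC s id; rewrite -Ds size_map_intr szP => ->.
  rewrite -(ler_int F) intr_norm -coef_map /= Ds -pmulrn natrX -szs.
  apply: coef_prod_XsubC_bound => a; rewrite -root_prod_XsubC -Ds; exact: PB.
apply: bigcup_finite; first by apply/finite_setIl/finite_bounded_int_poly.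
move=> P [_ monP].
have [s Ds] := closed_field_poly_normal (map_poly (intr : int -> F) P).
apply: (sub_finite_set _ (finite_seq s)) => x /=.
by rewrite Ds (monicP (monic_map _ monP)) scale1r root_prod_XsubC.
Qed.

(** The map [x -> x ^ 2 - 2] preserves the interval from -2 to 2 and sends
    [w + 1/w] to [w ^ 2 + 1/w ^ 2]. As only finitely many integers of a given
    degree have all their conjugates in that interval, the orbit of [r] is finite,
    so a power of [w] equals another one or its inverse. *)
Lemma Kronecker (F : numClosedFieldType) (r : F) (P : {poly int}) :
  P \is monic -> root (map_poly intr P) r ->
  (forall y : F, root (map_poly intr P) y -> y \is Num.real /\ `|y| <= 2%:R) ->
  exists w n, [/\ (0 < n)%N, w ^+ n = 1 & r = w + w^-1].
Proof.
move=> monP Pr P2.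
have szP : (1 < size P)%N.
  rewrite ltnNge; apply/negP => /size1_polyC DP; move: monP Pr.
  by rewrite DP monicE lead_coefC => /eqP ->; rewrite rmorph1 rootC oner_eq0.
pose A := [set x : F | exists Q : {poly int}, [/\ Q \is monic, size Q = size P,
  root (map_poly intr Q) x & forall y : F, root (map_poly intr Q) y -> y \is Num.real /\ `|y| <= 2%:R]].
have finA : finite_set A.
  apply: sub_finite_set (finite_bounded_integers F (size P) 2) => x /= [Q [? ? ? Q2]].
  by exists Q; split=> // y /Q2[].
pose T (x : F) := x ^+ 2 - 2%:R.
have AT x : A x -> A (T x).
  case=> Q [monQ szQ Qx Q2].
  have [|Q' [monQ' szQ' Q'x Q'P]] :=
    transform_roots (intr : {rmorphism int -> F}) ('X ^+ 2 - 2%:R) monQ.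
    by rewrite szQ.
  have TE y : (map_poly intr ('X ^+ 2 - 2%:R)).[y] = T y.
    by rewrite rmorphB rmorph_nat /= map_polyXn !hornerE.
  exists Q'; split=> //; first by rewrite szQ'.
    by rewrite -TE; apply: Q'x.
  move=> _ /Q'P[y /Q2[y_real y2] ->]; rewrite TE /T; split.
    by rewrite rpredB ?rpredX ?realn.
  have y_sq : 0 <= y ^+ 2 <= 2%:R + 2%:R.
    rewrite -real_normK // exprn_ge0 //= -natrD (_ : (2 + 2 = 2 * 2)%N) // natrM -expr2.
    by rewrite lerXn2r ?nnegrE ?normr_ge0.
  case/andP: y_sq => y_ge0 y_le4.
  rewrite real_ler_norml ?rpredB ?rpredX ?realn // lerBrDr addNr y_ge0.
  by rewrite lerBlDr.
have Aiter i : A (iter i T r) by elim: i => [|i /AT] //; exists P.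
have [w nz_w Dr] : exists2 w, w != 0 & r = w + w^-1.
  have [w] : exists w, root ('X^2 - r *: 'X + 1) w.
    apply/closed_rootP; rewrite -addrA size_polyDl size_polyXn //.
    rewrite (leq_ltn_trans (size_polyD _ _)) // gtn_max size_poly1 size_polyN.
    by rewrite (leq_ltn_trans (size_scale_leq _ _)) ?size_polyX.
  rewrite /root !hornerE => /eqP Dw.
  have nz_w : w != 0.
    by apply: contra_eq_neq Dw => ->; rewrite expr0n mulr0 subr0 add0r oner_eq0.
  exists w => //; apply: (mulIf nz_w); rewrite mulrDl mulVf //.
  by apply/eqP; rewrite -subr_eq0 -[_ == 0]oppr_eq0 -Dw; apply/eqP; ring.
have iterE i : iter i T r = w ^+ (2 ^ i) + w ^- (2 ^ i).
  elim: i => [|i /= ->]; first by rewrite expr1.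
  rewrite /T expnSr exprM; have := expf_neq0 (2 ^ i)%N nz_w.
  by move: (w ^+ _) => W nz_W; field.
have [i [j [lt_ij Eij]]] : exists i j, (i < j)%N /\ iter i T r = iter j T r.
  apply: contrapT => no_ij; apply: infinite_nat.
  rewrite -(eq_finite_set (inj_card_eq (f := fun i => iter i T r) _)).
    by apply: sub_finite_set finA => _ [i _ <-].
  move=> i j _ _ Eij; case: (ltngtP i j) => // lt_ij; case: no_ij.
    by exists i, j.
  by exists j, i.
have nz_wi k : w ^+ k != 0 by rewrite expf_neq0.
rewrite !iterE in Eij.
have lt_ij2 : (2 ^ i < 2 ^ j)%N by rewrite ltn_exp2l.
have : (w ^+ (2 ^ j) - w ^+ (2 ^ i)) * (w ^+ (2 ^ j) * w ^+ (2 ^ i) - 1) = 0.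
  transitivity ((w ^+ (2 ^ j) + w ^- (2 ^ j) - (w ^+ (2 ^ i) + w ^- (2 ^ i)))
      * w ^+ (2 ^ j) * w ^+ (2 ^ i)).
    have := nz_wi (2 ^ i)%N; have := nz_wi (2 ^ j)%N.
    by move: (w ^+ _) (w ^+ _) => U V nz_U nz_V; field; rewrite nz_U nz_V.
  by rewrite Eij subrr !mul0r.
move/eqP; rewrite mulf_eq0 !subr_eq0 -exprD => /orP[] /eqP w1.
  exists w, (2 ^ j - 2 ^ i)%N; split=> //; first by rewrite subn_gt0.
  apply: (mulIf (nz_wi (2 ^ i)%N)).
  by rewrite -exprD subnK ?(ltnW lt_ij2) // w1 mul1r.
by exists w, (2 ^ j + 2 ^ i)%N; split=> //; rewrite addn_gt0 expn_gt0.
Qed.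

(** * The fields of the theorem *)

Section MainTheorem.
Variable R : realType.
Local Notation C := R[i].
Implicit Types (S : set nat) (r w : C).

Lemma fixed_field_totally_real S : totally_real_field (fixed_field S : set C).
Proof.
split; first exact: fixed_field_divring_closed.
move=> z /fixed_field_conjugate[[Q nzQ Qz] z_real]; split; first by exists Q.
by move=> w [p [irrp pz pw]]; apply: z_real irrp pz pw.
Qed.

Lemma infinite_cubic_prime : infinite_set cubic_prime.
Proof.
move=> /finite_seqP[s Ds].
have [p lt_p Pp] := exists_cubic_prime (\max_(q <- s) q).
have : [set` s] p by rewrite -Ds.
move=> /= ps; move: lt_p; rewrite ltnNge => /negP; apply.
exact: (leq_bigmax_seq (F := fun q => q)).
Qed.

Lemma real_complex_between (w : C) (a b : R) :
  w \is Num.real -> (a%:C%C < w) -> (w < b%:C%C) ->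
  exists2 x : R, w = x%:C%C & (a%:E < x%:E < b%:E)%E.
Proof.
move=> w_real aw wb; exists (complex.Re w); first by rewrite RRe_real.
by rewrite !lte_fin -!ltcR RRe_real ?aw.
Qed.

Lemma exists_roots_of_unity :
  exists z : nat -> C, forall n, (0 < n)%N -> n.-primitive_root (z n).
Proof.
have /choice[z zP] : forall n, exists z : C, (0 < n)%N -> n.-primitive_root z.
  move=> [|n]; first by exists 0.
  by have [//|z] := @closed_prim_root_exists C n.+1; exists z.
by exists z.
Qed.

Local Notation eta p z := (map_poly (ratr : rat -> C) (period_poly p)).[z].

Lemma period_between S p (z : C) : cubic_prime p -> S p -> p.-primitive_root z ->
  conjugates_between0 (eta p z + 7%:R) 14%:R%:E.
Proof.
move=> [p_pr [p_gt7 _]] Sp prim_z w [q [irrq qz qw]].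
pose f : {poly rat} := period_poly p + 7%:R.
have fE y : (map_poly (ratr : rat -> C) f).[y] = eta p y + 7%:R.
  by rewrite rmorphD rmorph_nat hornerD -polyC_natr hornerC.
rewrite -fE in qz.
have [j co_jp ->] := irreducible_conj_prim_root prim_z irrq qz qw.
have zp1 := prim_expr_order prim_z.
have eta_real : eta p (z ^+ j) \is Num.real.
  apply: (fixed_field_conj_real (S := S) prim_z co_jp) => k [_ Sk].
  by apply: period_exponent => //; apply: Sk.
have norm_zj : `|z ^+ j| = 1.
  apply/eqP; rewrite -(pexpr_eq1 (prime_gt0 p_pr)) // -normrX exprAC zp1.
  by rewrite expr1n normr1.
have := period_norm p norm_zj; rewrite real_ler_norml // => /andP[eta_ge eta_le].
rewrite fE; apply: real_complex_between; first by rewrite rpredD ?realn.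
  rewrite rmorph0 -ltrBlDr sub0r (lt_le_trans _ eta_ge) //.
  by rewrite ltrN2 ltr_nat.
by rewrite rmorph_nat -ltrBrDr -natrB // (le_lt_trans eta_le) // ltr_nat.
Qed.

(** The integers are the Gaussian periods plus 7, with conjugates between 1 and
    13. *)
Lemma Aset_fixed_field_14 S : (forall p, S p -> cubic_prime p) -> infinite_set S ->
  Aset (ring_of_integers (fixed_field S : set C)) 14%:R%:E.
Proof.
move=> S_cubic S_inf; split=> //; have [z prim_z] := exists_roots_of_unity.
have zP p : S p -> p.-primitive_root (z p).
  by move=> /S_cubic[p_pr _]; apply/prim_z/prime_gt0.
pose f p : C := eta p (z p) + 7%:R.
(* Equal periods for [p] and [q] would put the period of [p] in the field attached
   to [S] without [p], where the period of [q] lies. *)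
have f_inj : {in S &, injective f}.
  move=> p q; rewrite !inE => Sp Sq /addIr Epq.
  apply: contrapT => ne_pq; pose S' := S `\ p.
  have S'_cubic t : S' t -> cubic_prime t by case=> /S_cubic.
  have [p_pr [p_gt7 _]] := S_cubic p Sp; have [q_pr [q_gt7 _]] := S_cubic q Sq.
  have S'q : S' q by split=> // Eqp; apply: ne_pq.
  have : S' p; last by case=> _ [].
  apply/(period_fixed_field p_pr S'_cubic p_gt7 (zP p Sp)).
  by rewrite Epq; apply/(period_fixed_field q_pr S'_cubic q_gt7 (zP q Sq)).
apply: (@sub_infinite_set _ (f @` S)); last first.
  by rewrite (eq_finite_set (inj_card_eq f_inj)).
move=> _ [p Sp <-]; have [p_pr [p_gt7 _]] := S_cubic p Sp; split; last first.
  exact: period_between (S_cubic p Sp) Sp (zP p Sp).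
split.
  rewrite /f -[7%:R]opprK; apply: fixed_field_sub.
    exact/(period_fixed_field p_pr S_cubic p_gt7 (zP p Sp)).
  exists p, (z p), (- 7%:R); split; first exact: zP.
  by move=> k _; rewrite rmorphN rmorph_nat hornerN -polyC_natr hornerC.
apply: integral_add (integral_nat _ 7).
by apply: period_integral => //; apply/prim_expr_order/zP.
Qed.

(** By Kronecker's theorem the integers counted here are [2 + w + 1/w] with [w] a
    root of unity, and only those with [w ^+ 12 = 1] lie in the field. *)
Lemma Aset_fixed_field_4 S : (forall p, S p -> cubic_prime p) ->
  ~ Aset (ring_of_integers (fixed_field S : set C)) 4%:R%:E.
Proof.
move=> S_cubic [_]; apply.
have fin12 : finite_set [set w : C | w ^+ 12 = 1].
  have [s Ds] := closed_field_poly_normal ('X^12 - 1 : {poly C}).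
  apply: (sub_finite_set _ (finite_seq s)) => w /= w12.
  rewrite -root_prod_XsubC; move: Ds; rewrite (monicP _) ?monicXnsubC // scale1r => <-.
  by rewrite /root !hornerE w12 subrr.
apply: sub_finite_set (finite_image (fun w => w + w^-1 + 2%:R) fin12).
move=> r [[Kr int_r] r_between]; have [P [monP Pr irrP]] := integral_minimal_polynomial int_r.
have szP : (1 < size P)%N by rewrite -(size_map_intr rat) irrP.1.
have [Q [monQ _ PQ QP]] :=
  transform_roots (intr : {rmorphism int -> C}) ('X - 2%:R) monP szP.
have shiftE y : (map_poly (intr : int -> C) ('X - 2%:R)).[y] = y - 2%:R.
  by rewrite rmorphB rmorph_nat /= map_polyX hornerD hornerN hornerX -polyC_natr hornerC.
have Qr : root (map_poly intr Q) (r - 2%:R) by rewrite -shiftE; apply: PQ.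
have [|w [n [n_gt0 wn1 Dr]]] := Kronecker monQ Qr.
  move=> _ /QP[y Py ->]; rewrite shiftE.
  have [|x -> /andP[x_gt0 x_lt4]] := r_between y.
    by exists (map_poly intr P); rewrite !map_poly_ratr_int.
  rewrite !lte_fin in x_gt0 x_lt4.
  have x_real : (x%:C%C - 2%:R : C) \is Num.real.
    by rewrite rpredB ?realn //; apply/complex_realP; exists x.
  split=> //; rewrite real_ler_norml // lerBrDr addNr lerBlDr -natrD.
  by rewrite -(rmorph0 (real_complex R)) -(rmorph_nat (real_complex R)) !lecR !ltW.
exists w; last by rewrite -Dr subrK.
apply: fixed_field_root_of_unity S_cubic n_gt0 wn1 _; rewrite -Dr.
apply: fixed_field_sub => //.
have [z prim_z] := @closed_prim_root_exists C 1 isT.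
exists 1%N, z, 2%:R; split=> // k _.
by rewrite rmorph_nat -polyC_natr hornerC.
Qed.

End MainTheorem.

Theorem theorem1p1 (R : realType) :
  infinite_set [set K : set R[i] |
    [/\ totally_real_field K,
        Aset (ring_of_integers K) <> [set +oo%E] &
        Aset (ring_of_integers K) <> [set t : \bar R | (4%:R%:E <= t)%E]]].
Proof.
pose K p : set R[i] := fixed_field (cubic_prime `\ p).
have S_cubic p q : (cubic_prime `\ p) q -> cubic_prime q by case.
have K_inj : {in (cubic_prime : set nat) &, injective K}.
  move=> p q; rewrite !inE => Pp Pq EK; apply: contrapT => ne_pq.
  have [z prim_z] := @exists_roots_of_unity R.
  have [p_pr [p_gt7 _]] := Pp; have zP := prim_z p (prime_gt0 p_pr).
  have : K p (map_poly ratr (period_poly p)).[z p].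
    by rewrite EK; apply/(period_fixed_field p_pr (S_cubic q) p_gt7 zP).
  by move/(period_fixed_field p_pr (S_cubic p) p_gt7 zP) => [_ []].
apply: (@sub_infinite_set _ (K @` cubic_prime)); last first.
  by rewrite (eq_finite_set (inj_card_eq K_inj)); apply: infinite_cubic_prime.
move=> _ [p Pp <-]; split; first exact: fixed_field_totally_real.
  have := @Aset_fixed_field_14 R _ (S_cubic p)
    (infinite_setD infinite_cubic_prime (finite_set1 p)).
  by rewrite -/(K p) => + EA; rewrite EA.
move=> EA; have := @Aset_fixed_field_4 R _ (S_cubic p).
by rewrite -/(K p) EA; apply; rewrite /= lexx.
Qed.
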